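(* Let $M\subseteq\mathbb{T}$ satisfy the standing hypothesis. The complete shell of $\rho^\forall_M$ for set-union is $\lambda X.\,X\cap M$; i.e., the $\sqsubseteq$-greatest upper closure operator $\eta$ on $\langle\wp(\mathbb{T}),\supseteq\rangle$ with $\eta\sqsubseteq\rho^\forall_M$ and $\eta(X\cup Y)=\eta(\eta(X)\cup\eta(Y))$ for all $X,Y\subseteq\mathbb{T}$ is $\lambda X.\,X\cap M$, whose set of fixpoints is $\{X\subseteq\mathbb{T}\mid X\subseteq M\}$.
   Context: $\mathbb{T}$ is the set of traces $\langle i,\sigma\rangle$, $i\in\mathbb{Z}$, $\sigma:\mathbb{Z}\to\mathbb{S}$; $X_{\downarrow s}=\{\langle i,\sigma\rangle\in X\mid\sigma_i=s\}$; $\oplus(X)=\{\langle i,\sigma\rangle\mid\langle i+1,\sigma\rangle\in X\}$, $\ominus(X)=\{\langle i,\sigma\rangle\mid\langle i-1,\sigma\rangle\in X\}$, $\curvearrowleft(X)=\{\langle -i,\lambda k.\sigma_{-k}\rangle\mid\langle i,\sigma\rangle\in X\}$. Standing hypothesis on $M$: (i) $|M_{\downarrow s}|>1$ for all $s$; (ii) $\oplus(M)=M=\ominus(M)$ and $\oplus(\curvearrowleft M)=\curvearrowleft M=\ominus(\curvearrowleft M)$. $\rho^\forall_M(X)=\{\langle i,\sigma\rangle\in M\mid M_{\downarrow\sigma_i}\subseteq X\}$. Upper closure operators on $\langle\wp(\mathbb{T}),\supseteq\rangle$: maps monotone w.r.t. $\subseteq$, idempotent, with $\rho(X)\subseteq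 X$; $\rho\sqsubseteq\eta$ iff $\rho(X)\supseteq\eta(X)$ for all $X$. *)

(* Defs.v *)
From mathcomp Require Import all_boot all_order all_algebra.
From mathcomp Require Import boolp classical_sets functions cardinality.

Set Implicit Arguments.
Unset Strict Implicit.
Unset Printing Implicit Defensive.

Local Open Scope classical_set_scope.
Local Open Scope card_scope.
Local Open Scope ring_scope.

Definition trace (S : Type) : Type := (int * (int -> S))%type.

Section Traces.
Variable S : Type.
Implicit Types (X M : set (trace S)) (s : S).

Definition present (t : trace S) : S := t.2 t.1.

Definition restrict_present X s : set (trace S) :=
  [set t | X t /\ present t = s].

Definition trace_next X : set (trace S) := [set t | X (t.1 + 1, t.2)].

Definition trace_prev X : set (trace S) := [set t | X (t.1 - 1, t.2)].

Definition reversal X : set (trace S) :=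
  [set (- t.1, fun k : int => t.2 (- k)) | t in X].

(* The library has no strict comparison of cardinals; in the first field,
   |A| > 1 is the negation of |A| <= |{0}|. *)
Record standing_hypothesis M : Prop := StandingHypothesis {
  standing_card : forall s, ~ (restrict_present M s #<= `I_1);
  standing_next : trace_next M = M;
  standing_prev : trace_prev M = M;
  standing_next_reversal : trace_next (reversal M) = reversal M;
  standing_prev_reversal : trace_prev (reversal M) = reversal M }.

Definition rho_forall M X : set (trace S) :=
  [set t | M t /\ restrict_present M (present t) `<=` X].

End Traces.

Section ClosureOperators.
Variable T : Type.
Implicit Types (rho eta : set T -> set T) (op : set T -> set T -> set T).

(* Upper closure operators on the powerset ordered by reverse inclusion, so
   extensivity reads rho X `<=` X. *)
Record is_uco rho : Prop := IsUco {
  uco_monotone : forall X Y, X `<=` Y -> rho X `<=` rho Y;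
  uco_idempotent : forall X, rho (rho X) = rho X;
  uco_extensive : forall X, rho X `<=` X }.

(* Pointwise order for reverse inclusion. *)
Definition uco_le rho eta : Prop := forall X, eta X `<=` rho X.

Definition complete_for op eta : Prop :=
  forall X Y, eta (op X Y) = eta (op (eta X) (eta Y)).

Definition complete_refinement op rho eta : Prop :=
  [/\ is_uco eta, uco_le eta rho & complete_for op eta].

Definition is_complete_shell op rho eta : Prop :=
  complete_refinement op rho eta /\
  (forall eta', complete_refinement op rho eta' -> uco_le eta' eta).

Definition fixpoints rho : set (set T) := [set X | rho X = X].

End ClosureOperators.

(* Main.v *)
(* Let t be in M, with present state s, and let A be the set of traces of M
   whose present state is s.  Since rho_forall M fixes A, so does every
   refinement eta of it.  Completeness for the union {t} U (A \ {t}) then gives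
   A = eta A `<=` eta {t} U eta (A \ {t}); as t is not in eta (A \ {t}), it
   belongs to eta {t}.  Hence X `&` M `<=` eta X for every X. *)
Require Import Defs.
From mathcomp Require Import all_boot all_order all_algebra.
From mathcomp Require Import boolp classical_sets functions cardinality.

Local Open Scope classical_set_scope.

Lemma setIr_uco (T : Type) (M : set T) : is_uco (fun X : set T => X `&` M).
Proof.
split=> [X Y XY|X|X]; first exact: setSI.
- by rewrite -setIA setIid.
- exact: subIsetl.
Qed.

Lemma setIr_complete_setU (T : Type) (M : set T) :
  complete_for (@setU T) (fun X : set T => X `&` M).
Proof. by move=> X Y; rewrite -setIUl -setIA setIid. Qed.

Lemma fixpoints_setIr (T : Type) (M : set T) :
  fixpoints (fun X : set T => X `&` M) = [set X : set T | X `<=` M].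
Proof.
by apply/seteqP; split=> X /=; [move=> <-; exact: subIsetr | exact: setIidl].
Qed.

Lemma rho_forall_subIr (S : Type) (M X : set (trace S)) :
  rho_forall M X `<=` X `&` M.
Proof. by move=> t [Mt MX]; split=> //; apply: MX; split. Qed.

(** All traces of the slice have present state [s], so the slice that [rho_forall] tests at each of
    them is this same one. *)
Lemma sub_rho_forall_restrict_present (S : Type) (M : set (trace S)) (s : S) :
  restrict_present M s `<=` rho_forall M (restrict_present M s).
Proof. by move=> t [Mt ts]; split=> //; rewrite ts. Qed.

Lemma complete_setU_singleton (T : Type) (eta : set T -> set T) (A : set T)
    (t : T) :
  is_uco eta -> complete_for (@setU T) eta -> A `<=` eta A -> A t ->
  eta [set t] t.
Proof.
move=> eta_uco etaU AeA At.
(* Extensivity strips the outer [eta] left by completeness; its second use, on [A] without [t],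
   refutes the other case. *)
have := AeA _ At; rewrite -(setD1K At) etaU => /(uco_extensive eta_uco)[//|].
by move=> /(uco_extensive eta_uco)[_ /(_ erefl)].
Qed.

Theorem theorem14 (S : Type) (M : set (trace S)) (hM : standing_hypothesis M) :
  is_complete_shell (@setU (trace S)) (rho_forall M)
    (fun X : set (trace S) => X `&` M) /\
  fixpoints (fun X : set (trace S) => X `&` M) =
    [set X : set (trace S) | X `<=` M].
Proof.
split; last exact: fixpoints_setIr.
split.
  split; [exact: setIr_uco | | exact: setIr_complete_setU].
  by move=> X; exact: rho_forall_subIr.
move=> eta [eta_uco le_eta etaU] X t [Xt Mt].
(* By monotonicity the singleton of [t] can replace [X], which need not contain the whole slice
   through [t]. *)
apply: (uco_monotone eta_uco (X := [set t])); first by move=> _ ->.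
apply: (@complete_setU_singleton _ _ (restrict_present M (present t))) => //.
by apply: subset_trans (le_eta _); exact: sub_rho_forall_restrict_present.
Qed.
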